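(* For every $\mathcal{L}$-frame $\mathbb{F}$ there exists a surjective p-morphism $(S,T):\mathbb{F}^{J}/\mathcal{U}\twoheadrightarrow\mathbb{F}^\star_{\mathbb{F}^+}$ for some set $J$ and some ultrafilter $\mathcal{U}$ over $J$.
   Context: Setting. $\mathcal{L}=\mathcal{L}(\mathcal{F},\mathcal{G})$ is an LE-signature: each $f\in\mathcal{F}$, $g\in\mathcal{G}$ has arity $n_f,n_g$ and order type $\epsilon_f\in\{1,\partial\}^{n_f}$, $\epsilon_g\in\{1,\partial\}^{n_g}$. A polarity is $(W,U,N)$, $N\subseteq W\times U$, with $X^{\uparrow}=\{u\mid\forall w\in X\,wNu\}$, $Y^{\downarrow}=\{w\mid\forall u\in Y\,wNu\}$; Galois stable sets are those with $X=X^{\uparrow\downarrow}$ (resp. $Y=Y^{\downarrow\uparrow}$). For a relation $S\subseteq A\times B_1\times\cdots\times B_n$, $S^{(0)}[\overline{C}]=\{a\mid\forall\overline{b}\in\overline{C}\,(a,\overline{b})\in S\}$, and $S^{(1)}[D]=\{b\mid\forall a\in D\,aSb\}$ for binary $S$. An $\mathcal{L}$-frame is $\mathbb{F}=(W,U,N,\{R_f\},\{R_g\})$ with $R_f\subseteq U\times\prod_iW^{\epsilon_f(i)}$, $R_g\subseteq W\times\prod_iU^{\epsilon_g(i)}$ ($W^1=W,W^\partial=U,U^1=U,U^\partial=W$), all single-point sections of these relations being Galois stable. Its complex algebra $\mathbb{F}^+$ is the concept lattice of pairs $a=([\![a]\!],(\![a]\!))$ with $[\![a]\!]\subseteq W$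 (extension), $(\![a]\!)\subseteq U$ (intension), $(\![a]\!)=[\![a]\!]^\uparrow$, $[\![a]\!]=(\![a]\!)^\downarrow$, with operations $f(\overline{a})=((R_f^{(0)}[\overline{Z}])^\downarrow,R_f^{(0)}[\overline{Z}])$, $Z_i=[\![a_i]\!]$ if $\epsilon_f(i)=1$ and $(\![a_i]\!)$ otherwise, and $g(\overline{a})=(R_g^{(0)}[\overline{Z}],(R_g^{(0)}[\overline{Z}])^\uparrow)$, $Z_i=(\![a_i]\!)$ if $\epsilon_g(i)=1$ and $[\![a_i]\!]$ otherwise. $\mathbb{F}^\star_{\mathbb{F}^+}$ (the filter-ideal extension) is the frame whose $W$ is the set of filters and $U$ the set of ideals of $\mathbb{F}^+$, with $FN^\star I$ iff $F\cap I\ne\varnothing$, $R^\star_f(I,\overline{F})$ iff $f(\overline{a})\in I$ for some $\overline{a}\in\overline{F}$, $R^\star_g(F,\overline{I})$ iff $g(\overline{a})\in F$ for some $\overline{a}\in\overline{I}$ (coordinates of order type $\partial$ range over ideals resp. filters). $\mathbb{F}^J/\mathcal{U}$ is the ultrapower: elements are $\mathcal{U}$-classes of functions $s:J\to W$, $t:J\to U$, relations holding iff they hold coordinatewise on a set in $\mathcal{U}$. A p-morphism $(S,T):\mathbb{F}_1\to\mathbb{F}_2$ is a pair $S\subseteq W_1\times U_2$, $T\subseteq U_1\times W_2$ with: $S^{(0)}[u]$, $S^{(1)}[w]$, $T^{(0)}[w]$, $T^{(1)}[u]$ Galois stable; $(T^{(0)}[w])^\downarrow\subseteq S^{(0)}[w^\uparrow]$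 for $w\in W_2$; $T^{(0)}[(S^{(1)}[w])^\downarrow]\subseteq w^\uparrow$ for $w\in W_1$; $T^{(0)}[((R^2_f)^{(0)}[\overline{w}])^\downarrow]=(R^1_f)^{(0)}[\overline{Z}]$ with $Z_i=(T^{(0)}[w_i])^\downarrow$ if $\epsilon_f(i)=1$, $Z_i=(S^{(0)}[w_i])^\uparrow$ if $\epsilon_f(i)=\partial$; and $S^{(0)}[((R^2_g)^{(0)}[\overline{u}])^\uparrow]=(R^1_g)^{(0)}[\overline{Z}]$ with $Z_i=(S^{(0)}[u_i])^\uparrow$ if $\epsilon_g(i)=1$, $Z_i=(T^{(0)}[u_i])^\downarrow$ if $\epsilon_g(i)=\partial$. It is surjective if $a\neq b$ in $\mathbb{F}_2^+$ implies $S^{(0)}[(\![a]\!)]\neq S^{(0)}[(\![b]\!)]$. *)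

(* Defs.v *)
From HB Require Import structures.
From mathcomp Require Import all_boot all_order.
From mathcomp Require Import boolp classical_sets filter.

Set Implicit Arguments.
Unset Strict Implicit.
Unset Printing Implicit Defensive.

Import Order.TTheory.
Local Open Scope order_scope.
Local Open Scope classical_set_scope.
Local Open Scope quotient_scope.

(** [otpos] is the order type 1 and [otneg] is the order type ∂. *)
Variant order_type := otpos | otneg.

Record LEsignature := LESignature {
  Fsym : Type;
  Gsym : Type;
  arF : Fsym -> nat;
  arG : Gsym -> nat;
  epsF : forall f : Fsym, 'I_(arF f) -> order_type;
  epsG : forall g : Gsym, 'I_(arG g) -> order_type
}.

Arguments epsF {l} f i.
Arguments epsG {l} g i.

(** With [A := W] and [B := U], [osel A B e] is W^e; with the arguments
    swapped it is U^e. *)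
Definition osel (A B : Type) (e : order_type) : Type :=
  match e with otpos => A | otneg => B end.

Definition oset (A B : Type) (e : order_type) (X : set A) (Y : set B) :
    set (osel A B e) :=
  match e with otpos => X | otneg => Y end.
Arguments oset {A B} e X Y _.

(** S^(0)[D] and S^(1)[C] for a binary relation S. *)
Definition sec0 (A B : Type) (S : A -> B -> Prop) (D : set B) : set A :=
  [set a | forall b, D b -> S a b].
Definition sec1 (A B : Type) (S : A -> B -> Prop) (C : set A) : set B :=
  [set b | forall a, C a -> S a b].

(** R^(0)[C_1, ..., C_n] for an (n+1)-ary relation R. *)
Definition nsec0 (A : Type) (n : nat) (B : 'I_n -> Type)
    (R : A -> (forall i, B i) -> Prop) (C : forall i, set (B i)) : set A :=
  [set a | forall b : forall i, B i, (forall i, C i (b i)) -> R a b].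

(** X^↑ and Y^↓ for the polarity (A, B, N). *)
Definition gup (A B : Type) (N : A -> B -> Prop) (X : set A) : set B := sec1 N X.
Definition gdown (A B : Type) (N : A -> B -> Prop) (Y : set B) : set A :=
  sec0 N Y.

Definition stable_l (A B : Type) (N : A -> B -> Prop) (X : set A) : Prop :=
  X = gdown N (gup N X).
Definition stable_r (A B : Type) (N : A -> B -> Prop) (Y : set B) : Prop :=
  Y = gup N (gdown N Y).

Definition stable_o (A B : Type) (N : A -> B -> Prop) (e : order_type) :
    set (osel A B e) -> Prop :=
  match e with otpos => @stable_l A B N | otneg => @stable_r A B N end.


Definition converse (A B : Type) (N : A -> B -> Prop) : B -> A -> Prop :=
  fun b a => N a b.

(** All sections of R ⊆ B × A^e_1 × ... × A^e_n obtained by fixing all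
    coordinates but one to single points are Galois stable.  This is the
    condition on R_f for [N : W -> U -> Prop], and the condition on R_g for the
    converse of [N].  In the second clause only the coordinates of [b] other
    than [i] matter. *)
Definition stable_sections (A B : Type) (N : A -> B -> Prop) (n : nat)
    (eps : 'I_n -> order_type)
    (R : B -> (forall i, osel A B (eps i)) -> Prop) : Prop :=
  (forall b, stable_r N [set a | R a b]) /\
  (forall (a : B) (b : forall i, osel A B (eps i)) (i : 'I_n),
     stable_o N [set x : osel A B (eps i) |
                   R a (@dfwith _ (fun k => osel A B (eps k)) b i x)]).

Record polarity := Polarity {
  polW : Type;
  polU : Type;
  polN : polW -> polU -> Prop
}.
Arguments polN p _ _ : clear implicits.

Record LEframe (L : LEsignature) := LEFrame {
  frP :> polarity;
  frF : forall f : Fsym L,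
    polU frP -> (forall i, osel (polW frP) (polU frP) (epsF f i)) -> Prop;
  frG : forall g : Gsym L,
    polW frP -> (forall i, osel (polU frP) (polW frP) (epsG g i)) -> Prop;
  frF_stable : forall f : Fsym L,
    stable_sections (polN frP) (@frF f);
  frG_stable : forall g : Gsym L,
    stable_sections (converse (polN frP)) (@frG g)
}.

Arguments frF {L} l f _ _.
Arguments frG {L} l g _ _.

Section GaloisTheory.
Context (A B : Type) (N : A -> B -> Prop).
Implicit Types (X : set A) (Y : set B).

Lemma sub_closure_l X : X `<=` gdown N (gup N X).
Proof. by move=> a Xa b; apply. Qed.

Lemma sub_closure_r Y : Y `<=` gup N (gdown N Y).
Proof. by move=> b Yb a; apply. Qed.

Lemma stable_lP X : gdown N (gup N X) `<=` X -> stable_l N X.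
Proof. by move=> h; apply/seteqP; split=> //; exact: sub_closure_l. Qed.

Lemma stable_rP Y : gup N (gdown N Y) `<=` Y -> stable_r N Y.
Proof. by move=> h; apply/seteqP; split=> //; exact: sub_closure_r. Qed.

Lemma stable_down Y : stable_l N (gdown N Y).
Proof. by apply: stable_lP => a ha b Yb; apply: ha => x; apply. Qed.

Lemma stable_up X : stable_r N (gup N X).
Proof. by apply: stable_rP => b hb a Xa; apply: hb => x; apply. Qed.

Lemma stable_l1 (b : B) : stable_l N [set a | N a b].
Proof. by apply: stable_lP => a; apply. Qed.

Lemma stable_r1 (a : A) : stable_r N [set b | N a b].
Proof. by apply: stable_rP => b; apply. Qed.

Lemma up_anti X X' : X `<=` X' -> gup N X' `<=` gup N X.
Proof. by move=> XX b hb a /XX; apply: hb. Qed.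

Lemma down_anti Y Y' : Y `<=` Y' -> gdown N Y' `<=` gdown N Y.
Proof. by move=> YY a ha b /YY; apply: ha. Qed.

Lemma upU X X' : gup N (X `|` X') = gup N X `&` gup N X'.
Proof.
apply/seteqP; split=> [b h|b [h h'] a [/h|/h']//].
by split=> a Xa; apply: h; [left|right].
Qed.

Lemma downU Y Y' : gdown N (Y `|` Y') = gdown N Y `&` gdown N Y'.
Proof.
apply/seteqP; split=> [b h|b [h h'] a [/h|/h']//].
by split=> a Xa; apply: h; [left|right].
Qed.

Lemma up0 : gup N set0 = setT.
Proof. by apply/seteqP; split=> b _ // a []. Qed.

Lemma down0 : gdown N set0 = setT.
Proof. by apply/seteqP; split=> b _ // a []. Qed.

Lemma stable_nsec0 n (eps : 'I_n -> order_type)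
    (R : B -> (forall i, osel A B (eps i)) -> Prop) C :
  stable_sections N R -> stable_r N (nsec0 R C).
Proof.
move=> [sR _]; apply: stable_rP => b hb c Cc.
suff: [set b | R b c] b by [].
by rewrite sR => a ha; apply: hb => b' hb'; apply: ha; exact: hb'.
Qed.

End GaloisTheory.

Record concept (P : polarity) := Concept {
  ext : set (polW P);
  int : set (polU P);
  int_ext : int = gup (polN P) ext;
  ext_int : ext = gdown (polN P) int
}.

Section ConceptLattice.
Context (P : polarity).
Local Notation N := (polN P).
Implicit Types a b c : concept P.

Lemma ext_inj : injective (@ext P).
Proof.
case=> X Y h1 h2 [X' Y' h1' h2'] /= e; case: _ / e h1' h2' => h1' h2'.
have e : Y = Y' by rewrite h1 h1'.
by case: _ / e h1' h2' => h1' h2'; congr Concept; apply: Prop_irrelevance.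
Qed.

Lemma int_inj : injective (@int P).
Proof. by move=> a b e; apply: ext_inj; rewrite (ext_int a) (ext_int b) e. Qed.

Lemma ext_stable a : stable_l N (ext a).
Proof. by rewrite /stable_l -int_ext -ext_int. Qed.

Lemma int_stable a : stable_r N (int a).
Proof. by rewrite /stable_r -ext_int -int_ext. Qed.

Definition concept_of_ext (X : set (polW P)) (sX : stable_l N X) : concept P :=
  Concept (erefl (gup N X)) sX.

Definition concept_of_int (Y : set (polU P)) (sY : stable_r N Y) : concept P :=
  Concept sY (erefl (gdown N Y)).

Definition concept_le a b : bool := `[< ext a `<=` ext b >].

Lemma stable_extI a b : stable_l N (ext a `&` ext b).
Proof. by rewrite (ext_int a) (ext_int b) -downU; exact: stable_down. Qed.

Lemma stable_intI a b : stable_r N (int a `&` int b).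
Proof. by rewrite (int_ext a) (int_ext b) -upU; exact: stable_up. Qed.

Lemma stable_extT : stable_l N setT.
Proof. by apply: stable_lP. Qed.

Lemma stable_intT : stable_r N setT.
Proof. by apply: stable_rP. Qed.

Definition concept_meet a b : concept P := concept_of_ext (stable_extI a b).
Definition concept_join a b : concept P := concept_of_int (stable_intI a b).
Definition concept_top : concept P := concept_of_ext stable_extT.
Definition concept_bot : concept P := concept_of_int stable_intT.

Lemma concept_le_int a b : concept_le a b = `[< int b `<=` int a >].
Proof.
apply/asboolP/asboolP => h.
  by rewrite (int_ext a) (int_ext b); exact: up_anti.
by rewrite (ext_int a) (ext_int b); exact: down_anti.
Qed.

Lemma concept_le_refl : reflexive concept_le.
Proof. by move=> a; apply/asboolP. Qed.

Lemma concept_le_anti : antisymmetric concept_le.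
Proof.
move=> a b /andP[/asboolP ab /asboolP ba].
by apply: ext_inj; apply/seteqP; split.
Qed.

Lemma concept_le_trans : transitive concept_le.
Proof.
move=> b a c /asboolP ab /asboolP bc.
by apply/asboolP; exact: subset_trans bc.
Qed.

HB.instance Definition _ := gen_eqMixin (concept P).
HB.instance Definition _ := gen_choiceMixin (concept P).

Definition concept_display : Order.disp_t := Order.Disp tt tt.

HB.instance Definition _ := Order.Le_isPOrder.Build concept_display (concept P)
  concept_le_refl concept_le_anti concept_le_trans.

Lemma concept_meetP a b c :
  (a <= concept_meet b c) = (a <= b) && (a <= c).
Proof.
apply/asboolP/andP => [h|[/asboolP h1 /asboolP h2] x ax]; last first.
  by split; [exact: h1|exact: h2].
by split; apply/asboolP => x /h [].
Qed.

Lemma concept_joinP a b c :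
  (concept_join a b <= c) = (a <= c) && (b <= c).
Proof.
rewrite /Order.le /= !concept_le_int.
apply/asboolP/andP => [h|[/asboolP h1 /asboolP h2] x ax]; last first.
  by split; [exact: h1|exact: h2].
by split; apply/asboolP => x /h [].
Qed.

HB.instance Definition _ := Order.POrder_MeetJoin_isLattice.Build
  concept_display (concept P) concept_meetP concept_joinP.

Lemma concept_le0x a : concept_bot <= a.
Proof. by rewrite /Order.le /= concept_le_int; apply/asboolP. Qed.

Lemma concept_lex1 a : a <= concept_top.
Proof. by apply/asboolP. Qed.

HB.instance Definition _ :=
  Order.hasBottom.Build concept_display (concept P) concept_le0x.
HB.instance Definition _ :=
  Order.hasTop.Build concept_display (concept P) concept_lex1.

End ConceptLattice.

Section OrderTypeLattice.
Context (d : Order.disp_t) (A : tbLatticeType d).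

(** The lattice operations of A^e, where A^∂ is the dual of A. *)
Definition ojoin (e : order_type) (x y : A) : A :=
  match e with otpos => (x `|` y)%O | otneg => (x `&` y)%O end.
Definition omeet (e : order_type) (x y : A) : A :=
  match e with otpos => (x `&` y)%O | otneg => (x `|` y)%O end.
Definition obot (e : order_type) : A :=
  match e with otpos => \bot | otneg => \top end.
Definition otop (e : order_type) : A :=
  match e with otpos => \top | otneg => \bot end.

Definition f_normal (n : nat) (eps : 'I_n -> order_type)
    (h : ('I_n -> A) -> A) : Prop :=
  forall (a : 'I_n -> A) (i : 'I_n),
    (forall x y, h [eta a with i |-> ojoin (eps i) x y] =
       (h [eta a with i |-> x] `|` h [eta a with i |-> y])%O) /\
    h [eta a with i |-> obot (eps i)] = \bot.

Definition g_normal (n : nat) (eps : 'I_n -> order_type)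
    (h : ('I_n -> A) -> A) : Prop :=
  forall (a : 'I_n -> A) (i : 'I_n),
    (forall x y, h [eta a with i |-> omeet (eps i) x y] =
       (h [eta a with i |-> x] `&` h [eta a with i |-> y])%O) /\
    h [eta a with i |-> otop (eps i)] = \top.

End OrderTypeLattice.

Record LEalgebra (L : LEsignature) := LEAlgebra {
  alg_disp : Order.disp_t;
  alg_lat :> tbLatticeType alg_disp;
  algF : forall f : Fsym L, ('I_(arF f) -> alg_lat) -> alg_lat;
  algG : forall g : Gsym L, ('I_(arG g) -> alg_lat) -> alg_lat;
  algF_normal : forall f : Fsym L, f_normal (epsF f) (@algF f);
  algG_normal : forall g : Gsym L, g_normal (epsG g) (@algG g)
}.

Section NormalSections.
Context (A B : Type) (N : A -> B -> Prop) (n : nat).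
Context (eps : 'I_n -> order_type).
Context (R : B -> (forall i, osel A B (eps i)) -> Prop).
Context (sR : stable_sections N R).

Definition closure_o (e : order_type) : set (osel A B e) -> set (osel A B e) :=
  match e with
  | otpos => fun X => gdown N (gup N X)
  | otneg => fun Y => gup N (gdown N Y)
  end.

Lemma closure_o_stable e (X Z : set (osel A B e)) :
  stable_o N Z -> X `<=` Z -> closure_o X `<=` Z.
Proof.
case: e X Z => X Z /= sZ XZ; rewrite sZ.
  by apply: down_anti; apply: up_anti.
by apply: up_anti; apply: down_anti.
Qed.

Lemma sub_closure_o e (X : set (osel A B e)) : X `<=` closure_o X.
Proof. by case: e X => X; [exact: sub_closure_l|exact: sub_closure_r]. Qed.

Local Notation upd b i x := (@dfwith _ (fun k => osel A B (eps k)) b i x).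

Lemma dfwith_same (b : forall i, osel A B (eps i)) i : upd b i (b i) = b.
Proof. by apply: functional_extensionality_dep => k; case: dfwithP. Qed.

Lemma nsec0_union (C C1 C2 : forall i, set (osel A B (eps i))) i :
  (forall k, k != i -> C k = C1 k) -> (forall k, k != i -> C k = C2 k) ->
  C i = closure_o (C1 i `|` C2 i) ->
  nsec0 R C = nsec0 R C1 `&` nsec0 R C2.
Proof.
move=> e1 e2 ei; apply/seteqP; split=> [u hu|u [h1 h2] b Cb].
  have le D : (forall k, k != i -> C k = D k) -> D i `<=` C i ->
      nsec0 R D u.
    move=> eD Di b Db; apply: hu => k.
    by have [->|ki] := eqVneq k i; [exact: Di|rewrite eD].
  split; apply: le; rewrite ?ei // => x Dx; apply: sub_closure_o.
    by left.
  by right.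
rewrite -(dfwith_same b i).
suff: C i `<=` [set x | R u (upd b i x)] by apply; exact: Cb.
rewrite ei; apply: closure_o_stable; first exact: sR.2.
move=> x [] Dx; [apply: h1|apply: h2] => k; case: dfwithP => // j ij.
  by rewrite -e1 // eq_sym.
by rewrite -e2 // eq_sym.
Qed.

Lemma nsec0_bot (C : forall i, set (osel A B (eps i))) i :
  C i = closure_o set0 -> nsec0 R C = setT.
Proof.
move=> ei; apply/seteqP; split=> // u _ b Cb.
rewrite -(dfwith_same b i).
suff: C i `<=` [set x | R u (upd b i x)] by apply; exact: Cb.
by rewrite ei; apply: closure_o_stable; first exact: sR.2.
Qed.

End NormalSections.

Section ComplexAlgebra.
Context (L : LEsignature) (F : LEframe L).

Definition complex_F (f : Fsym L) (a : 'I_(arF f) -> concept F) : concept F :=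
  concept_of_int (stable_nsec0
    (fun i => oset (epsF f i) (ext (a i)) (int (a i))) (frF_stable F f)).

(** Stability with respect to the converse of N is definitionally
    [stable_l]. *)
Definition complex_G (g : Gsym L) (a : 'I_(arG g) -> concept F) : concept F :=
  @concept_of_ext F _ (stable_nsec0
    (fun i => oset (epsG g i) (int (a i)) (ext (a i))) (frG_stable F g)).

Lemma complex_F_normal (f : Fsym L) : f_normal (epsF f) (@complex_F f).
Proof.
move=> a i; split=> [x y|]; apply: int_inj.
  apply: (nsec0_union (frF_stable F f) (i := i)) => [k|k|] /=;
    rewrite ?eqxx //; try by move=> /negbTE ->.
  by case: (epsF f i) => /=; rewrite ?upU ?downU -?int_ext -?ext_int.
apply: (nsec0_bot (frF_stable F f) (i := i)) => /=; rewrite eqxx.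
by case: (epsF f i) => /=; rewrite ?up0 ?down0.
Qed.

Lemma complex_G_normal (g : Gsym L) : g_normal (epsG g) (@complex_G g).
Proof.
move=> a i; split=> [x y|]; apply: ext_inj.
  apply: (nsec0_union (frG_stable F g) (i := i)) => [k|k|] /=;
    rewrite ?eqxx //; try by move=> /negbTE ->.
  case: (epsG g i) => /=.
    rewrite -[gdown _ _]/(gup (polN F) _).
    by rewrite -[gup (converse _) _]/(gdown (polN F) _) downU -!ext_int.
  rewrite -[gup (converse _) _]/(gdown (polN F) _).
  by rewrite -[gdown (converse _) _]/(gup (polN F) _) upU -!int_ext.
apply: (nsec0_bot (frG_stable F g) (i := i)) => /=; rewrite eqxx.
case: (epsG g i) => /=.
  by rewrite -[gup (converse _) _]/(gdown (polN F) _) down0.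
by rewrite -[gdown (converse _) _]/(gup (polN F) _) up0.
Qed.

Definition complex_algebra : LEalgebra L :=
  @LEAlgebra L concept_display (concept F) complex_F complex_G
    complex_F_normal complex_G_normal.

End ComplexAlgebra.

Section FiltersIdeals.
Context (d : Order.disp_t) (A : tbLatticeType d).

(** Improper filters and ideals are allowed. *)
Record lfilter := LFilter {
  lfilter_set :> set A;
  lfilter_neq0 : lfilter_set !=set0;
  lfilter_le : forall x y, x <= y -> lfilter_set x -> lfilter_set y;
  lfilter_meet : forall x y,
    lfilter_set x -> lfilter_set y -> lfilter_set (x `&` y)%O
}.

Record lideal := LIdeal {
  lideal_set :> set A;
  lideal_neq0 : lideal_set !=set0;
  lideal_le : forall x y, y <= x -> lideal_set x -> lideal_set y;
  lideal_join : forall x y,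
    lideal_set x -> lideal_set y -> lideal_set (x `|` y)%O
}.

Definition fi_N (F : lfilter) (I : lideal) : Prop := (F `&` I) !=set0.

Definition omem_FI (e : order_type) : osel lfilter lideal e -> set A :=
  match e with otpos => lfilter_set | otneg => lideal_set end.

Definition omem_IF (e : order_type) : osel lideal lfilter e -> set A :=
  match e with otpos => lideal_set | otneg => lfilter_set end.

Definition fi_F (n : nat) (eps : 'I_n -> order_type) (h : ('I_n -> A) -> A)
    (I : lideal) (Fs : forall i, osel lfilter lideal (eps i)) : Prop :=
  exists a : 'I_n -> A, (forall i, omem_FI (Fs i) (a i)) /\ lideal_set I (h a).

Definition fi_G (n : nat) (eps : 'I_n -> order_type) (h : ('I_n -> A) -> A)
    (F : lfilter) (Is : forall i, osel lideal lfilter (eps i)) : Prop :=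
  exists a : 'I_n -> A, (forall i, omem_IF (Is i) (a i)) /\ lfilter_set F (h a).

End FiltersIdeals.

(** A bare lattice, so that the result applies to a lattice and to its dual. *)
Section FilterIdealStable.
Context (T : Type) (le : T -> T -> Prop) (meet join : T -> T -> T).
Context (top bot : T).
Context (le_refl : forall x, le x x).
Context (le_trans : forall x y z, le x y -> le y z -> le x z).
Context (le_meet : forall x y z, le x y -> le x z -> le x (meet y z)).
Context (meet_l : forall x y, le (meet x y) x).
Context (meet_r : forall x y, le (meet x y) y).
Context (join_l : forall x y, le x (join x y)).
Context (join_r : forall x y, le y (join x y)).
Context (bot_le : forall x, le bot x).
Context (join_eq : forall x y, le x y -> join x y = y).
Context (meet_eq : forall x y, le x y -> meet y x = x).

Context (Fi Id : Type) (mF : Fi -> set T) (mI : Id -> set T).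
Let isF (X : set T) := [/\ X !=set0, (forall x y, le x y -> X x -> X y) &
  (forall x y, X x -> X y -> X (meet x y))].
Let isI (X : set T) := [/\ X !=set0, (forall x y, le y x -> X x -> X y) &
  (forall x y, X x -> X y -> X (join x y))].
Context (mF_isF : forall F, isF (mF F)).
Context (mI_isI : forall I, isI (mI I)).
Context (isF_mF : forall X, isF X -> exists F, mF F = X).
Context (isI_mI : forall X, isI X -> exists I, mI I = X).

Let mem e : osel Fi Id e -> set T :=
  match e with otpos => mF | otneg => mI end.
Let oj e x y := match e with otpos => join x y | otneg => meet x y end.
Let om e x y := match e with otpos => meet x y | otneg => join x y end.
Let ob e := match e with otpos => bot | otneg => top end.
Let ole e x y := match e with otpos => le x y | otneg => le y x end.

Context (n : nat) (eps : 'I_n -> order_type) (h : ('I_n -> T) -> T).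
Context (hj : forall (a : 'I_n -> T) i x y,
  h [eta a with i |-> oj (eps i) x y] =
  join (h [eta a with i |-> x]) (h [eta a with i |-> y])).
Context (hb : forall (a : 'I_n -> T) i,
  h [eta a with i |-> ob (eps i)] = bot).

Lemma fis_upd_id (a : 'I_n -> T) i :
  ([eta a with i |-> a i] : 'I_n -> T) = a.
Proof. by apply/funext => k /=; case: eqVneq => [->|]. Qed.

Lemma fis_mono1 (a : 'I_n -> T) i x y :
  ole (eps i) x y -> le (h [eta a with i |-> x]) (h [eta a with i |-> y]).
Proof.
move=> xy; have -> : y = oj (eps i) x y.
  move: xy; rewrite /ole /oj; case: (eps i) => xy; first by rewrite join_eq.
  by rewrite meet_eq.
by rewrite hj; apply: join_l.
Qed.

Lemma fis_mono (a b : 'I_n -> T) :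
  (forall i, ole (eps i) (a i) (b i)) -> le (h a) (h b).
Proof.
move=> ab; pose c m (i : 'I_n) := if (i < m)%N then b i else a i.
have -> : a = c 0 by apply/funext => i; rewrite /c ltn0.
have -> : b = c n by apply/funext => i; rewrite /c ltn_ord.
have : (n <= n)%N by [].
elim: {1 3}n => [//|m IH] mn; apply: le_trans (IH (ltnW mn)) _.
pose i := Ordinal mn.
have -> : c m = ([eta c m with i |-> a i] : 'I_n -> T).
  by apply/funext => k /=; case: eqVneq => [->|//]; rewrite /c /= ltnn.
have -> : c m.+1 = ([eta c m with i |-> b i] : 'I_n -> T).
  apply/funext => k /=; case: eqVneq => [->|ki]; rewrite /c /= ?ltnSn //.
  by rewrite ltnS leq_eqVlt (negbTE (_ : k != m :> nat)).
exact: fis_mono1.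
Qed.

Lemma fis_om_l e x y : ole e (om e x y) x.
Proof. by case: e; [exact: meet_l|exact: join_l]. Qed.

Lemma fis_om_r e x y : ole e (om e x y) y.
Proof. by case: e; [exact: meet_r|exact: join_r]. Qed.

Lemma fis_mem0 e (X : osel Fi Id e) : exists x, mem X x.
Proof.
by case: e X => X; [have [] := mF_isF X|have [] := mI_isI X].
Qed.

Lemma fis_mem_om e (X : osel Fi Id e) x y :
  mem X x -> mem X y -> mem X (om e x y).
Proof.
by case: e X => X; [have [_ _ +] := mF_isF X|have [_ _ +] := mI_isI X]; apply.
Qed.

Lemma fis_pt (Fs : forall i, osel Fi Id (eps i)) :
  exists a : 'I_n -> T, forall i, mem (Fs i) (a i).
Proof.
by have [a ha] := boolp.choice (fun i => fis_mem0 (Fs i)); exists a.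
Qed.

Lemma fi_stable_sections :
  @stable_sections Fi Id (fun F I => (mF F `&` mI I) !=set0) n eps
    (fun I Fs => exists a : 'I_n -> T, (forall i, mem (Fs i) (a i)) /\ mI I (h a)).
Proof.
set N := fun (F : Fi) (I : Id) => _; set R := fun (I : Id) Fs => _; split=> [Fs|I Fs i].
  have [|F eF] := @isF_mF
      [set x | exists a, (forall i, mem (Fs i) (a i)) /\ le (h a) x].
    split.
    - by have [a ha] := fis_pt Fs; exists (h a), a.
    - by move=> x y xy [a [ma ax]]; exists a; split=> //; apply: le_trans xy.
    - move=> x y [a [ma ax]] [b [mb bx]].
      exists (fun i => om (eps i) (a i) (b i)); split.
        by move=> i; apply: fis_mem_om.
      apply: le_meet; [apply: le_trans ax|apply: le_trans bx];
        apply: fis_mono => i; [exact: fis_om_l|exact: fis_om_r].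
  suff -> : [set I | R I Fs] = [set I | N F I] by exact: stable_r1.
  apply/seteqP; split=> I.
    by move=> [a [ma Ia]]; exists (h a); split=> //; rewrite eF; exists a.
  move=> [x []]; rewrite eF => -[a [ma ax]] Ix; exists a; split=> //.
  by have [_ Ile _] := mI_isI I; apply: Ile Ix.
have [[z Iz] Ile Ij] := mI_isI I.
pose D := [set x | exists a : 'I_n -> T, (forall k, k != i -> mem (Fs k) (a k)) /\
  mI I (h [eta a with i |-> x])].
have D0 : D (ob (eps i)).
  have [a ma] := fis_pt Fs; exists a; split=> //.
  by rewrite hb; apply: Ile Iz.
have Dle x y : ole (eps i) y x -> D x -> D y.
  move=> yx [a [ma Ia]]; exists a; split=> //; apply: Ile Ia; exact: fis_mono1.
have Dj x y : D x -> D y -> D (oj (eps i) x y).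
  move=> [a [ma Ia]] [b [mb Ib]]; exists (fun k => om (eps k) (a k) (b k)).
  split=> [k ki|]; first by apply: fis_mem_om; [exact: ma|exact: mb].
  rewrite hj; apply: Ij; [apply: Ile Ia|apply: Ile Ib]; apply: fis_mono => k /=;
    case: eqVneq => [->|_]; rewrite ?/ole; try by case: (eps i).
    exact: fis_om_l.
  exact: fis_om_r.
have DE : [set X | R I (@dfwith _ (fun k => osel Fi Id (eps k)) Fs i X)] =
    [set X | exists x, mem X x /\ D x].
  apply/seteqP; split=> X.
    move=> [a [ma Ia]]; exists (a i); split.
      by have := ma i; rewrite dfwith_in.
    exists a; split; last by rewrite fis_upd_id.
    by move=> k ki; have := ma k; rewrite dfwith_out // eq_sym.
  move=> [x [Xx [a [ma Ia]]]]; exists ([eta a with i |-> x] : 'I_n -> T); split=> // k.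
  case: dfwithP => [|k' ik] /=; first by rewrite eqxx.
  by rewrite eq_sym (negbTE ik); apply: ma; rewrite eq_sym.
rewrite DE; move: D0 Dle Dj; clear DE; rewrite /ole /oj /ob.
move: D; case: (eps i) => D D0 Dle Dj.
  have [|J eJ] := @isI_mI D.
    by split=> //; exists bot.
  suff -> : [set X | exists x, @mem otpos X x /\ D x] = [set X | N X J].
    exact: stable_l1.
  by rewrite /N eJ; apply/seteqP; split=> X [x []]; exists x.
have [|J eJ] := @isF_mF D.
  by split=> //; exists top.
suff -> : [set X | exists x, @mem otneg X x /\ D x] = [set X | N J X].
  exact: stable_r1.
by rewrite /N eJ; apply/seteqP; split=> X [x []]; exists x.
Qed.

End FilterIdealStable.

Section FilterIdealFrame.
Context (L : LEsignature) (A : LEalgebra L).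

Lemma fi_F_stable (f : Fsym L) :
  stable_sections (@fi_N _ A) (@fi_F _ A _ (epsF f) (@algF L A f)).
Proof.
apply: (@fi_stable_sections A (fun x y => x <= y) Order.meet Order.join \top \bot
  _ _ _ _ _ _ _ _ _ _ (lfilter A) (lideal A)
  (@lfilter_set _ A) (@lideal_set _ A)).
- by [].
- by move=> x y z; exact: le_trans.
- by move=> x y z xy xz; rewrite lexI xy.
- by move=> x y; rewrite leIl.
- by move=> x y; rewrite leIr.
- by move=> x y; rewrite leUl.
- by move=> x y; rewrite leUr.
- by move=> x; rewrite le0x.
- by move=> x y; exact: join_r.
- by move=> x y; exact: meet_r.
- by move=> [].
- by move=> [].
- by move=> X [h1 h2 h3]; exists (LFilter h1 h2 h3).
- by move=> X [h1 h2 h3]; exists (LIdeal h1 h2 h3).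
- by move=> a i x y; have [+ _] := algF_normal (f := f) a i; apply.
- by move=> a i; have [_] := algF_normal (f := f) a i.
Qed.

Lemma fi_G_stable (g : Gsym L) :
  stable_sections (converse (@fi_N _ A)) (@fi_G _ A _ (epsG g) (@algG L A g)).
Proof.
have -> : converse (@fi_N _ A) =
    fun I F => (lideal_set I `&` lfilter_set F) !=set0.
  by apply/funext => I; apply/funext => F; rewrite /converse /fi_N setIC.
apply: (@fi_stable_sections A (fun x y => y <= x) Order.join Order.meet \bot \top
  _ _ _ _ _ _ _ _ _ _ (lideal A) (lfilter A)
  (@lideal_set _ A) (@lfilter_set _ A)).
- by [].
- by move=> x y z xy yz; exact: le_trans xy.
- by move=> x y z xy xz; rewrite leUx xy.
- by move=> x y; rewrite leUl.
- by move=> x y; rewrite leUr.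
- by move=> x y; rewrite leIl.
- by move=> x y; rewrite leIr.
- by move=> x; rewrite lex1.
- by move=> x y; exact: meet_r.
- by move=> x y; exact: join_r.
- by move=> [].
- by move=> [].
- by move=> X [h1 h2 h3]; exists (LIdeal h1 h2 h3).
- by move=> X [h1 h2 h3]; exists (LFilter h1 h2 h3).
- by move=> a i x y; have [+ _] := algG_normal (g := g) a i; apply.
- by move=> a i; have [_] := algG_normal (g := g) a i.
Qed.

Definition filter_ideal_frame : LEframe L :=
  @LEFrame L (Polarity (@fi_N _ A))
    (fun f => @fi_F _ A _ (epsF f) (@algF L A f))
    (fun g => @fi_G _ A _ (epsG g) (@algG L A g))
    fi_F_stable fi_G_stable.

End FilterIdealFrame.

Section Ultrapower.
Context (J : Type) (V : set_system J) {FV : UltraFilter V}.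

Section UltraQuotient.
Context (X : Type).

Definition ueq (s t : {classic J -> X}) : bool := `[< V [set j | s j = t j] >].

Lemma ueq_refl : reflexive ueq.
Proof. by move=> s; apply/asboolP; apply: filterS filterT. Qed.

Lemma ueq_sym : symmetric ueq.
Proof. by move=> s t; apply/asboolP/asboolP; apply: filterS. Qed.

Lemma ueq_trans : transitive ueq.
Proof.
move=> t s r /asboolP st /asboolP tr; apply/asboolP.
by apply: filterS (filterI st tr) => j [/= -> ->].
Qed.

Definition ueq_equiv := EquivRel ueq ueq_refl ueq_sym ueq_trans.

(** The set X^J/V of V-classes of functions J -> X. *)
Definition upow : Type := {eq_quot ueq_equiv}.

Definition uclass (s : J -> X) : upow := \pi_{eq_quot ueq_equiv} s.

Definition urepr (x : upow) : J -> X := repr (x : {eq_quot ueq_equiv}).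

Lemma ureprK (x : upow) : uclass (urepr x) = x.
Proof. exact: reprK. Qed.

Lemma uclassP (s t : J -> X) : uclass s = uclass t <-> V [set j | s j = t j].
Proof.
split=> [/eqP|st]; first by rewrite eqmodE => /asboolP.
by apply/eqP; rewrite eqmodE; apply/asboolP.
Qed.

Lemma urepr_class (s : J -> X) : V [set j | urepr (uclass s) j = s j].
Proof. by apply/uclassP; rewrite ureprK. Qed.

End UltraQuotient.

(** The relations of the ultrapower are given through representatives; they do
    not depend on the choice of these, see [upow_relE] and [upow_nrelE]. *)
Definition upow_rel (A B : Type) (N : A -> B -> Prop) (x : upow A) (y : upow B) :
    Prop :=
  V [set j | N (urepr x j) (urepr y j)].

Definition oclass (A B : Type) (e : order_type) :
    (J -> osel A B e) -> osel (upow A) (upow B) e :=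
  match e with otpos => @uclass A | otneg => @uclass B end.

Definition orepr (A B : Type) (e : order_type) :
    osel (upow A) (upow B) e -> J -> osel A B e :=
  match e with otpos => @urepr A | otneg => @urepr B end.

Definition upow_nrel (A B C : Type) (n : nat) (eps : 'I_n -> order_type)
    (R : C -> (forall i, osel A B (eps i)) -> Prop) (y : upow C)
    (x : forall i, osel (upow A) (upow B) (eps i)) : Prop :=
  V [set j | R (urepr y j) (fun i => orepr (x i) j)].

Lemma upow_relE (A B : Type) (N : A -> B -> Prop) (s : J -> A) (t : J -> B) :
  upow_rel N (uclass s) (uclass t) <-> V [set j | N (s j) (t j)].
Proof.
have h1 := urepr_class s; have h2 := urepr_class t.
by rewrite /upow_rel; split=> hN; 
  apply: filterS (filterI (filterI h1 h2) hN) => j [] [/= -> ->].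
Qed.

Lemma filter_forall_ord n (P : 'I_n -> set J) :
  (forall i, V (P i)) -> V [set j | forall i, P i j].
Proof.
elim: n P => [|n IH] P VP; first by apply: filterS filterT => j _ [].
apply: filterS (filterI (VP ord0) (IH _ (fun i => VP (lift ord0 i)))).
by move=> j [P0 PS] i; case: (unliftP ord0 i) => [k ->|->].
Qed.

Lemma orepr_class (A B : Type) e (s : J -> osel A B e) :
  V [set j | orepr (oclass s) j = s j].
Proof. by case: e s => s; exact: urepr_class. Qed.

Lemma upow_nrelE (A B C : Type) (n : nat) (eps : 'I_n -> order_type)
    (R : C -> (forall i, osel A B (eps i)) -> Prop) (t : J -> C)
    (s : forall i, J -> osel A B (eps i)) :
  upow_nrel R (uclass t) (fun i => oclass (s i)) <->
  V [set j | R (t j) (fun i => s i j)].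
Proof.
have h1 := urepr_class t.
have h2 := filter_forall_ord (fun i => orepr_class (s i)).
rewrite /upow_nrel.
split=> hN; apply: filterS (filterI (filterI h1 h2) hN) => j [] [/= -> ej];
  by rewrite (functional_extensionality_dep ej).
Qed.

Lemma upow_stable_r (A B : Type) (N : A -> B -> Prop) (Y : J -> set B) :
  (forall j, stable_r N (Y j)) ->
  stable_r (upow_rel N) [set y | V [set j | Y j (urepr y j)]].
Proof.
move=> sY; apply: stable_rP => y hy.
have [//|VnY] := in_ultra_setVsetC [set j | Y j (urepr y j)] FV.
have w_ex j : ~ Y j (urepr y j) ->
    exists a, gdown N (Y j) a /\ ~ N a (urepr y j).
  move=> nY; apply: contrapT => h; apply: nY; rewrite sY => a ha.
  by apply: contrapT => na; apply: h; exists a.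
have [j0 nY0] : exists j, ~ Y j (urepr y j) by exact: filter_ex VnY.
have [a0 _] := w_ex _ nY0.
have /boolp.choice[s hs] : forall j, exists a, ~ Y j (urepr y j) ->
    gdown N (Y j) a /\ ~ N a (urepr y j).
  move=> j; have [Yj|nYj] := EM (Y j (urepr y j)); first by exists a0.
  by have [a ha] := w_ex _ nYj; exists a.
have /hy : gdown (upow_rel N) [set y | V [set j | Y j (urepr y j)]] (uclass s).
  move=> z Vz; rewrite -(ureprK z); apply/upow_relE.
  by apply: filterS (filterI VnY Vz) => j [/hs[+ _]]; apply.
rewrite -{1}(ureprK y) => /upow_relE Vy.
have [j [/hs[_ +]]] := filter_ex (filterI VnY Vy).
by [].
Qed.

Lemma upow_stable_sections (A B : Type) (N : A -> B -> Prop) (n : nat)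
    (eps : 'I_n -> order_type) (R : B -> (forall i, osel A B (eps i)) -> Prop) :
  stable_sections N R -> stable_sections (upow_rel N) (upow_nrel R).
Proof.
move=> [s0 si]; split=> [b|a b i].
  by apply: (@upow_stable_r _ _ N (fun j => [set a | R a _])).
have e j x : (fun k => orepr (@dfwith _ (fun k => osel (upow A) (upow B) (eps k))
      b i x k) j) =
    @dfwith _ (fun k => osel A B (eps k)) (fun k => orepr (b k) j) i (orepr x j).
  apply: functional_extensionality_dep => k; case: dfwithP => [|k' ik].
    by rewrite dfwith_in.
  by rewrite dfwith_out.
have -> : [set x | upow_nrel R a (@dfwith _
      (fun k => osel (upow A) (upow B) (eps k)) b i x)] =
    [set x | V [set j | R (urepr a j)
       (@dfwith _ (fun k => osel A B (eps k)) (fun k => orepr (b k) j) i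
          (orepr x j))]].
  apply/funext => x; rewrite /upow_nrel /=; congr V.
  by apply/funext => j /=; rewrite e.
pose D j := [set x | R (urepr a j) (@dfwith _ (fun k => osel A B (eps k))
   (fun k => orepr (b k) j) i x)].
have sD j : stable_o N (D j) by exact: si.
rewrite -[X in stable_o _ X]/[set x | V [set j | D j (orepr x j)]].
move: D sD {e}; case: (eps i) => D sD.
  exact: (@upow_stable_r _ _ (converse N) D).
exact: (@upow_stable_r _ _ N D).
Qed.

Definition ultrapower (L : LEsignature) (F : LEframe L) : LEframe L :=
  @LEFrame L (Polarity (upow_rel (polN F)))
    (fun f => upow_nrel (frF F f))
    (fun g => upow_nrel (frG F g))
    (fun f => upow_stable_sections (frF_stable F f))
    (fun g => upow_stable_sections (frG_stable F g)).

End Ultrapower.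

Arguments ultrapower {J} V {FV L} F.

(** In [pmor_F] and [pmor_G], R^(0)[w] for a tuple w of points is the set of
    all a with R(a, w), and w^↑ is the set {w}^↑. *)
Record pmorphism (L : LEsignature) (F1 F2 : LEframe L)
    (S : polW F1 -> polU F2 -> Prop) (T : polU F1 -> polW F2 -> Prop) : Prop :=
  PMorphism {
  pmor_S0 : forall u : polU F2, stable_l (polN F1) [set w | S w u];
  pmor_S1 : forall w : polW F1, stable_r (polN F2) [set u | S w u];
  pmor_T0 : forall w : polW F2, stable_r (polN F1) [set u | T u w];
  pmor_T1 : forall u : polU F1, stable_l (polN F2) [set w | T u w];
  pmor_TS : forall w : polW F2,
    gdown (polN F1) [set u | T u w] `<=` sec0 S (gup (polN F2) [set w]);
  pmor_ST : forall w : polW F1,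
    sec0 T (gdown (polN F2) [set u | S w u]) `<=` gup (polN F1) [set w];
  pmor_F : forall (f : Fsym L)
      (w : forall i, osel (polW F2) (polU F2) (epsF f i)),
    sec0 T (gdown (polN F2) [set u | frF F2 f u w]) =
    nsec0 (frF F1 f) (fun i =>
      match epsF f i as e return
        osel (polW F2) (polU F2) e -> set (osel (polW F1) (polU F1) e)
      with
      | otpos => fun wi => gdown (polN F1) [set u | T u wi]
      | otneg => fun wi => gup (polN F1) [set w | S w wi]
      end (w i));
  pmor_G : forall (g : Gsym L)
      (u : forall i, osel (polU F2) (polW F2) (epsG g i)),
    sec0 S (gup (polN F2) [set w | frG F2 g w u]) =
    nsec0 (frG F1 g) (fun i =>
      match epsG g i as e return
        osel (polU F2) (polW F2) e -> set (osel (polU F1) (polW F1) e)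
      with
      | otpos => fun ui => gup (polN F1) [set w | S w ui]
      | otneg => fun ui => gdown (polN F1) [set u | T u ui]
      end (u i))
}.

Definition surjective_pmorphism (L : LEsignature) (F1 F2 : LEframe L)
    (S : polW F1 -> polU F2 -> Prop) (T : polU F1 -> polW F2 -> Prop) : Prop :=
  pmorphism S T /\
  forall a b : concept F2, a <> b -> sec0 S (int a) <> sec0 S (int b).

(* Main.v *)
Require Import Defs.
From HB Require Import structures.
From mathcomp Require Import all_boot all_order.
From mathcomp Require Import boolp classical_sets filter wochoice.

Set Implicit Arguments.
Unset Strict Implicit.
Unset Printing Implicit Defensive.

Local Open Scope classical_set_scope.

(** Let a^* be the set of points x of the ultrapower with x_j in [[a]] for almost
    all j, and a_* the set of those y with y_j in ((a)) for almost all j.  Then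
    S relates x to the ideals containing some a with x in a^*, and T relates y
    to the filters containing some a with y in a_*.  All conditions on (S, T)
    are clear except those asking, for a family of filters and ideals and an
    internal set, for a point of that set lying in a^* or a_* for all members a
    simultaneously.  Finitely many members are dealt with by directedness, so
    it suffices that the ultrapower realizes internal types indexed by the
    complex algebra; hence V is taken to be good, following Kunen: starting
    from an independent family of functions on J, V is built by a transfinite
    induction which uses up finitely many members of the family at each step. *)

(** * Well-orders with short initial segments *)

(** [I] plays the initial ordinal of the cardinality of [T]: it is the segment below the least point
    whose segment maps onto [T], or all of [T] if no segment does. *)
Lemma short_well_order (T : eqType) :
  exists (lt : T -> T -> Prop) (I : set T) (tau : T -> T),
    [/\ well_founded lt,
        (forall x y z, lt x y -> lt y z -> lt x z) /\
        (forall x y, [\/ x = y, lt x y | lt y x]),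
        (forall x y, I y -> lt x y -> I x),
        (forall z, exists2 x, I x & tau x = z) &
        forall (phi : T -> T) x, I x ->
          exists z, forall y, lt y x -> phi y <> z].
Proof.
have [R Rwo] := well_ordering_principle T.
pose lt x y := R x y && (x != y).
have Rmin (A : set T) : A !=set0 -> exists2 z, A z & forall x, A x -> R z x.
  move=> [a Aa]; have [|z [[Az zP] _]] := Rwo (mem A).
    by exists a; rewrite inE.
  by exists z; [rewrite inE in Az|move=> x Ax; apply: zP; rewrite inE].
have Rwc : wo_chain R predT by move=> A _ /Rwo.
have Rtot x y : R x y || R y x by exact: (wo_chainW Rwc).
have Ranti x y : R x y -> R y x -> x = y.
  by move=> xy yx; apply: (wo_chain_antisymmetric Rwc); rewrite ?xy.
have Rtr x y z : R x y -> R y z -> R x z.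
  move=> xy yz; have [|m] := Rmin [set x; y; z]; first by exists x; left; left.
  move=> [[->|->]|->] h; first by apply: h; right.
    by rewrite (Ranti x y) //; apply: h; left; left.
  by rewrite -(Ranti y z) //; apply: h; left; right.
have lt_total x y : [\/ x = y, lt x y | lt y x].
  have [->|nxy] := eqVneq x y; first by constructor 1.
  have /orP[xy|yx] := Rtot x y; first by constructor 2; rewrite /lt xy.
  by constructor 3; rewrite /lt yx eq_sym.
have lt_trans x y z : lt x y -> lt y z -> lt x z.
  move=> /andP[xy nxy] /andP[yz nyz]; rewrite /lt (Rtr _ _ _ xy yz) /=.
  by apply: contra nxy => /eqP xz; apply/eqP/Ranti => //; rewrite xz.
have lt_wf : well_founded lt.
  move=> x; apply: contrapT => nx.
  have [|z nz zP] := Rmin [set x | ~ Acc lt x]; first by exists x.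
  apply: nz; constructor=> y /andP[yz nyz]; apply: contrapT => /zP zy.
  by move: nyz; rewrite (Ranti y z) ?eqxx.
have [|] := pselect (exists x, exists phi : T -> T,
    forall z, exists2 y, lt y x & phi y = z); last first.
  move=> h; exists lt, setT, id; split=> // [z|phi x _]; first by exists z.
  apply: contrapT => nz; apply: h; exists x, phi => z.
  by apply: contrapT => hz; apply: nz; exists z => y yx e; apply: hz; exists y.
move=> /Rmin[x [tau xtau] xP]; exists lt, (lt ^~ x), tau; split=> //.
  by move=> y z zx yz; exact: lt_trans zx.
move=> phi y /andP[yx nyx]; apply: contrapT => nz.
suff xy : R x y by move: nyx; rewrite (Ranti y x) ?eqxx.
apply: xP; exists phi => z.
by apply: contrapT => hz; apply: nz; exists z => u uy e; apply: hz; exists u.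
Qed.

(** * Independent families and one step of the construction *)

Section GoodUltrafilter.
Context (X : eqType).
Local Notation M := (seq X).

(* The index set J of the ultrafilter.  It contains codes for the elements of
   nat * M * J, so that subsets of J encode all the maps M -> set J and all the
   sequences of subsets of J; its last two components make the functions
   [coord] independent. *)
Inductive tree := Node of nat & M & seq tree & (seq bool -> M).
Local Notation T := (set tree).

HB.instance Definition _ := gen_eqMixin tree.

(** As in Hausdorff's independent families: [s] is a finite list of test points, and [r] depends
    only on the trace of [U] on it. *)
Definition coord (U : T) (j : tree) : M :=
  let: Node _ _ s r := j in r [seq `[< U k >] | k <- s].

Definition pair_tree n m k := Node n m [:: k] (fun=> [::]).

Definition task (U : T) (m : M) : set tree := [set k | U (pair_tree 0 m k)].

Lemma task_surj f : exists U, task U = f.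
Proof.
exists [set t | exists m k, t = pair_tree 0 m k /\ f m k].
apply/funext => m; apply/funext => k; apply/propext; split.
  by move=> [m' [k' [[-> ->]]]].
by move=> fmk; exists m, k.
Qed.

(** Collect in [s] points telling the members of [l] apart; their traces on [s] differ, so [r] can
    take any prescribed value on each. *)
Lemma coord_indep (l : seq T) (xi : T -> M) :
  exists j, forall U, U \in l -> coord U j = xi U.
Proof.
pose t0 := Node 0 [::] [::] (fun=> [::]).
have /boolp.choice[d dP] : forall p : T * T, exists k, p.1 k = p.2 k -> p.1 = p.2.
  move=> [U V] /=; apply: contrapT => h.
  have e : U = V.
    by apply/funext => k; apply: contrapT => nk; apply: h; exists k => /nk.
  by apply: h; exists t0.
pose s := [seq d (U, V) | U <- l, V <- l].
pose mk (U : T) := [seq `[< U k >] | k <- s].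
have mk_inj U V : U \in l -> V \in l -> mk U = mk V -> U = V.
  move=> lU lV; move=> /eq_in_map e; apply: (dP (U, V)) => /=.
  apply/propext; apply: asbool_eq_equiv; apply: e.
  by apply/allpairsP; exists (U, V).
exists (Node 0 [::] s
  (fun m => xi (nth set0 l (find (fun U => mk U == m) l)))) => U lU /=.
congr xi; apply: mk_inj => //.
  by rewrite mem_nth // -has_find; apply/hasP; exists U.
by apply/eqP/(@nth_find _ _ (fun V => mk V == mk U)); apply/hasP; exists U.
Qed.

(* Koenig's diagonal argument, as T maps onto nat -> T. *)
Lemma countable_cover (Z : set T) (e : T -> nat -> T) :
  (forall U, exists2 z, Z z & exists n, e z n = U) ->
  exists phi : T -> T, forall U, exists2 z, Z z & phi z = U.
Proof.
move=> eP; apply: contrapT => h.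
pose dec (U : T) n : T := [set k | U (pair_tree n [::] k)].
have /boolp.choice[V VP] : forall n, exists V, forall z, Z z -> dec (e z n) n <> V.
  move=> n; apply: contrapT => hn; apply: h; exists (fun z => dec (e z n) n) => U.
  by apply: contrapT => hU; apply: hn; exists U => z Zz ez; apply: hU; exists z.
have [z Zz [n]] := eP [set t | exists n k, t = pair_tree n [::] k /\ V n k].
move=> ez; apply: (VP n z Zz); rewrite ez; apply/funext => k; apply/propext.
split; last by move=> Vnk; exists n, k.
by move=> [n' [k' [[-> ->]]]].
Qed.

Definition cond (l : seq T) (xi : T -> M) : set tree :=
  [set j | forall U, U \in l -> coord U j = xi U].

(** [H] collects the coordinates already spent. *)
Definition indep (D : set_system tree) (H : set T) :=
  forall E l xi, D E -> (forall U, U \in l -> ~ H U) -> (E `&` cond l xi) !=set0.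

(** Goodness in Kunen's sense: these sets are multiplicative in [s], and lie inside [f s] when [f]
    is antitone. *)
Definition refined (D : set_system tree) (f : M -> set tree) :=
  exists g : tree -> M, forall s : M,
    D [set j | {subset s <= g j} /\ f (g j) j].

Definition decided (D : set_system tree) (f : M -> set tree) :=
  (exists s, D (~` f s)) \/ refined D f.

Definition adjoin (D : set_system tree) (p : M -> set tree) : set_system tree :=
  [set B | exists E s, D E /\ E `&` p s `<=` B].

Lemma adjoin_filter D p : Filter D ->
  (forall s t, p (s ++ t) `<=` p s `&` p t) -> Filter (adjoin D p).
Proof.
move=> FD pP; split.
- by exists setT, [::]; split=> //; exact: filterT.
- move=> A B [E [s [DE EA]]] [E' [t [DE' EB]]].
  exists (E `&` E'), (s ++ t); split; first exact: filterI.
  by move=> j [[Ej E'j] /pP[ps pt]]; split; [apply: EA|apply: EB].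
- move=> A B AB [E [s [DE EA]]]; exists E, s; split=> //.
  exact: subset_trans AB.
Qed.

Lemma sub_adjoin D p : D `<=` adjoin D p.
Proof. by move=> E DE; exists E, [::]; split=> // j []. Qed.

Lemma adjoin_mem D p s : Filter D -> adjoin D p (p s).
Proof. by move=> FD; exists setT, s; split; [exact: filterT|move=> j []]. Qed.

(* If ~` f s cannot be added to D for any s, a fresh coordinate U0 serves as g in
   [refined]: on the set where it equals s, the condition at s is f s. *)
Lemma decide_step (D : set_system tree) (H : set T) f :
  Filter D -> indep D H -> (exists U, ~ H U) ->
  exists D' (l : seq T), [/\ Filter D', D `<=` D',
    indep D' (H `|` [set U | U \in l]) & decided D' f].
Proof.
move=> FD iD [U0 HU0].
have [[s [E [l [xi [DE Hl Efl]]]]]|nokill] := pselect (exists s E (l : seq T) xi,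
    [/\ D E, forall U, U \in l -> ~ H U & E `&` cond l xi `<=` ~` f s]).
  (* A condition on free coordinates forces the complement of [f s]; it is added to the filter at
     the cost of spending [l]. *)
  exists (adjoin D (fun=> cond l xi)), l; split.
  - by apply: adjoin_filter => // _ _ j.
  - exact: sub_adjoin.
  - move=> B l' xi' [E' [_ [DE' E'B]]] Hl'.
    (* [l'] avoids [l], so both prescriptions can be imposed at once. *)
    pose xi'' U := if U \in l then xi U else xi' U.
    have [U|j [E'j cj]] := iD E' (l ++ l') xi'' DE'.
      rewrite mem_cat => /orP[/Hl//|/Hl' nHl] HU.
      by apply: nHl; left.
    exists j; split=> [|U Ul'].
      apply: E'B; split=> // U Ul; rewrite cj ?mem_cat ?Ul //.
      by rewrite /xi'' Ul.
    rewrite cj ?mem_cat ?Ul' ?orbT // /xi'' ifN //.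
    by apply/negP => Ul; apply: (Hl' U Ul'); right.
  - by left; exists s; exists E, [::].
pose p (s : M) : set tree :=
  [set j | {subset s <= coord U0 j} /\ f (coord U0 j) j].
exists (adjoin D p), [:: U0]; split.
- apply: adjoin_filter => // s t j [st fj].
  by split; split=> // x xs; apply: st; rewrite mem_cat xs ?orbT.
- exact: sub_adjoin.
- move=> B l xi [E [s [DE EB]]] Hl.
  pose xi' U := if U == U0 then s else xi U.
  (* Otherwise [xi'] on [U0 :: l] would force the complement of [f s], against [nokill]. *)
  have [j [[Ej cj] fj]] : exists j, (E `&` cond (U0 :: l) xi') j /\ f s j.
    apply: contrapT => h; apply: nokill; exists s, E, (U0 :: l), xi'; split=> //.
      move=> U; rewrite inE => /orP[/eqP->//|/Hl nHl] HU.
      by apply: nHl; left.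
    by move=> j Ej fj; apply: h; exists j.
  have cU0 : coord U0 j = s by rewrite cj ?mem_head // /xi' eqxx.
  exists j; split; first by apply: EB; split; rewrite // /p /mkset cU0; split.
  move=> U Ul; rewrite cj ?inE ?Ul ?orbT // /xi' ifN //.
  by apply/eqP => UU0; apply: (Hl U Ul); right; rewrite UU0 /= mem_head.
- by right; exists (coord U0) => s; exact: adjoin_mem.
Qed.

(** * The transfinite construction of the ultrafilter *)

Section Construction.
Context (lt : T -> T -> Prop) (I : set T) (tau : T -> T).
Context (lt_wf : well_founded lt).
Context (lt_trans : forall U V W, lt U V -> lt V W -> lt U W).
Context (lt_total : forall U V, [\/ U = V, lt U V | lt V U]).
Context (I_down : forall U V, I V -> lt U V -> I U).
Context (tau_surj : forall V, exists2 U, I U & tau U = V).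
Context (short : forall (phi : T -> T) U, I U ->
          exists W, forall V, lt V U -> phi V <> W).

Definition state : Type := set_system tree * seq T.

Definition good_step (D : set_system tree) (H : set T) (f : M -> set tree)
    (s : state) :=
  [/\ Filter s.1, D `<=` s.1, indep s.1 (H `|` [set U | U \in s.2])
    & decided s.1 f].

(** The clause [E = setT] keeps this a filter at the first stage, where the union is empty. *)
Definition before (U : T) (rec : forall V, lt V U -> state) : set_system tree :=
  [set E | E = setT \/ exists V (h : lt V U), (rec V h).1 E].

Definition used (U : T) (rec : forall V, lt V U -> state) : set T :=
  [set W | exists V (h : lt V U), W \in (rec V h).2].

(** An arbitrary good step is chosen; [stage_good] shows that one exists at every stage in [I]. *)
Definition stage : T -> state := Fix lt_wf (fun=> state) (fun U rec =>
  xget ([set setT], [::] : seq T)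
    [set s : {classic state} | good_step (before rec) (used rec) (task (tau U)) s]).

Definition before_stage U := @before U (fun V _ => stage V).
Definition used_stage U := @used U (fun V _ => stage V).

Lemma stageE U : stage U = xget ([set setT], [::] : seq T)
  [set s : {classic state} |
    good_step (before_stage U) (used_stage U) (task (tau U)) s].
Proof.
rewrite /stage Fix_eq // => V r1 r2 r12.
suff -> : r1 = r2 by [].
by apply: functional_extensionality_dep => W; apply: functional_extensionality_dep.
Qed.

Lemma used_lt U V : lt V U ->
  used_stage V `|` [set W | W \in (stage V).2] `<=` used_stage U.
Proof.
move=> VU W [[V' [V'V WV']]|WV]; last by exists V, VU.
by exists V', (lt_trans V'V VU).
Qed.

(** Each earlier stage spends a finite list. If these exhausted [T], [countable_cover] would map the
    segment below [U] onto [T], against [short]. *)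
Lemma not_all_used U : I U -> exists W, ~ used_stage U W.
Proof.
move=> IU; apply: contrapT => h.
have [W|phi phiP] := @countable_cover (lt ^~ U) (fun V => nth set0 (stage V).2).
  have [V [VU WV]] : used_stage U W by apply: contrapT => hW; apply: h; exists W.
  by exists V => //; exists (index W (stage V).2); rewrite nth_index.
have [W] := short phi IU.
by have [V VU <-] := phiP W; move/(_ V VU).
Qed.

Lemma stage_good U : I U ->
  good_step (before_stage U) (used_stage U) (task (tau U)) (stage U).
Proof.
elim/(well_founded_ind lt_wf): U => U IH IU.
have sub V W : lt V U -> lt W V -> (stage W).1 `<=` (stage V).1.
  move=> VU WV; have [_ + _ _] := IH V VU (I_down IU VU); apply: subset_trans.
  by move=> E WE; right; exists W, WV.
rewrite stageE; set P := [set s | _]; suff : P (xget ([set setT], [::]) P) by [].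
apply: xgetPex.
have [| | |D' [l [h1 h2 h3 h4]]] :=
    @decide_step (before_stage U) (used_stage U) (task (tau U)).
- split; first by left.
  + move=> A B [->|[V [VU VA]]]; first by rewrite setTI.
    move=> [->|[W [WU WB]]]; first by rewrite setIT; right; exists V, VU.
    right; have [FV _ _ _] := IH V VU (I_down IU VU).
    have [FW _ _ _] := IH W WU (I_down IU WU).
    have [VW|VW|WV] := lt_total V W.
    * by subst W; exists V, VU; exact: (@filterI _ _ FV _ _ VA WB).
    * by exists W, WU; exact: (@filterI _ _ FW _ _ (sub _ _ WU VW _ VA) WB).
    * by exists V, VU; exact: (@filterI _ _ FV _ _ VA (sub _ _ VU WV _ WB)).
  + move=> A B AB [AT|[V [VU VA]]].
      by left; apply/seteqP; split=> // x _; apply: AB; rewrite AT.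
    right; exists V, VU; have [FV _ _ _] := IH V VU (I_down IU VU).
    exact: (@filterS _ _ FV _ _ AB VA).
(* For [setT] this is [coord_indep]; any other [E] comes from an earlier stage, whose spent
   coordinates remain spent. *)
- move=> E l xi [->|[V [VU VE]]] Hl.
    by have [j jP] := coord_indep l xi; exists j.
  have [_ _ iV _] := IH V VU (I_down IU VU).
  by apply: iV VE _ => W /Hl nW /(used_lt VU).
- exact: not_all_used.
- by exists (D', l).
Qed.

Lemma stage_mono U V : I U -> lt V U -> (stage V).1 `<=` (stage U).1.
Proof.
move=> IU VU E VE; have [_ + _ _] := stage_good IU; apply.
by right; exists V, VU.
Qed.

Definition limit : set_system tree := [set E | exists2 U, I U & (stage U).1 E].

Lemma limit_proper : ProperFilter limit.
Proof.
apply: Build_ProperFilter_ex => [E [U IU UE]|].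
  have [_ _ iU _] := stage_good IU.
  (* Independence with an empty prescription says that [E] is nonempty. *)
  by have [//|j [Ej _]] := iU E [::] (fun=> [::]) UE; exists j.
split.
- have [U IU _] := tau_surj set0; exists U => //.
  by have [FU _ _ _] := stage_good IU; exact: filterT.
- move=> A B [U IU UA] [V IV VB].
  have [FU _ _ _] := stage_good IU; have [FV _ _ _] := stage_good IV.
  have [UV|UV|VU] := lt_total U V.
  + by exists U => //; apply: filterI => //; rewrite UV.
  + by exists V => //; apply: filterI => //; exact: stage_mono UA.
  + by exists U => //; apply: filterI => //; exact: stage_mono VB.
- move=> A B AB [U IU UA]; exists U => //.
  have [FU _ _ _] := stage_good IU; exact: filterS UA.
Qed.

Lemma limit_decided f : decided limit f.
Proof.
have [U <-] := task_surj f; have [V IV <-] := tau_surj U.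
have [_ _ _ [[s sP]|[g gP]]] := stage_good IV; [left|right].
  by exists s; exists V.
by exists g => s; exists V.
Qed.

(** Deciding the constant map at [A] puts [A] or its complement into the filter. *)
Lemma limit_ultra : UltraFilter limit.
Proof.
split=> [|G PG sG]; first exact: limit_proper.
apply/seteqP; split=> // A GA.
have [[_ /sG GnA]|[g /(_ [::]) gP]] := limit_decided (fun=> A).
  have : G set0 by rewrite -(setICr A); exact: filterI.
  by case/filter_ex.
have FL : Filter limit by have [] := limit_proper.
by apply: filterS gP => j [].
Qed.

Lemma limit_refined f : (forall s, limit (f s)) -> refined limit f.
Proof.
move=> fP; have [[s sP]|//] := limit_decided f.
have PL := limit_proper.
have : limit set0 by rewrite -(setICr (f s)); exact: filterI.
by case/filter_ex.
Qed.

End Construction.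

Theorem good_ultrafilter :
  exists (J : Type) (V : set_system J), UltraFilter V /\
    forall f : M -> set J, (forall s, V (f s)) ->
    exists g : J -> M, forall s : M, V [set j | {subset s <= g j} /\ f (g j) j].
Proof.
have [lt [I [tau [wf [tr tot] dn su sh]]]] := short_well_order T.
exists tree, (limit I tau wf); split; first exact: limit_ultra.
by move=> f; exact: limit_refined.
Qed.

End GoodUltrafilter.

(** * Saturation of the ultrapower *)

(** Realization of finitely satisfiable internal types indexed by [X], stated for
    representatives. *)
Definition saturating (J : Type) (V : set_system J) (X : eqType) :=
  forall (Y : Type) (Q : X -> J -> set Y),
    (forall s : seq X, V [set j | exists y, forall a, a \in s -> Q a j y]) ->
    exists y : J -> Y, forall a, V [set j | Q a j (y j)].

(** At [j] the point is chosen to meet the finitely many conditions in [g j]; each condition belongs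
    to [g j] for almost all [j]. *)
Lemma saturated_ultrafilter (X : eqType) :
  exists (J : Type) (V : set_system J), UltraFilter V /\ saturating V X.
Proof.
have [J [V [UV gV]]] := good_ultrafilter X; exists J, V; split=> // Y Q QP.
have [g gP] := gV _ QP.
have [_ [y0 _]] := filter_ex (QP [::]).
have /boolp.choice[y yP] : forall j, exists y,
    (exists y, forall a, a \in g j -> Q a j y) -> forall a, a \in g j -> Q a j y.
  move=> j; have [[y yP]|n] := pselect (exists y, forall a, a \in g j -> Q a j y).
    by exists y.
  (* A default where the conditions in [g j] are inconsistent. *)
  by exists y0.
exists y => a; apply: filterS (gP [:: a]) => j [ag /yP]; apply.
by apply: ag; rewrite mem_head.
Qed.

Section TupleSaturation.
Context (J : Type) (V : set_system J) {FV : UltraFilter V} (X : eqType).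
Context (sat : saturating V X).

(** The condition with index [a] constrains every coordinate [i] with [P i a], so [X] still indexes
    the type. Directedness reduces finitely many conditions to one per coordinate. *)
Lemma tuple_saturation (I : Type) (Y : I -> Type) (P : I -> set X)
    (C : forall i, X -> set (Y i)) (D : J -> set (forall i, Y i)) :
  (forall i (s : seq X), exists2 a, P i a &
     forall b, b \in s -> P i b -> C i a `<=` C i b) ->
  (forall a : I -> X, (forall i, P i (a i)) ->
     V [set j | exists2 y, D j y & forall i, C i (a i) (y i)]) ->
  exists y : J -> forall i, Y i, forall a,
    V [set j | D j (y j) /\ forall i, P i a -> C i a (y j i)].
Proof.
move=> dirP DP; apply: (sat (Q := fun a j y =>
  D j y /\ forall i, P i a -> C i a (y i))) => s.
have /boolp.choice[a aP] : forall i, exists a, P i a /\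
    forall b, b \in s -> P i b -> C i a `<=` C i b.
  by move=> i; have [a Pa aP] := dirP i s; exists a.
apply: filterS (DP a (fun i => (aP i).1)) => j [y Dy Cy].
by exists y => b bs; split=> // i Pb; apply: ((aP i).2 b bs Pb); exact: Cy.
Qed.

End TupleSaturation.

(* A lattice of concepts with its filters and ideals, packaged so that passing
   to the converse polarity exchanges all the roles, see [dual]. *)
Record concept_lattice := ConceptLattice {
  clA : Type;
  clB : Type;
  clN : clA -> clB -> Prop;
  clX :> eqType;
  clE : clX -> set clA;
  clI : clX -> set clB;
  clI_E : forall a, clI a = gup clN (clE a);
  clE_I : forall a, clE a = gdown clN (clI a);
  clmeet : clX -> clX -> clX;
  cljoin : clX -> clX -> clX;
  cltop : clX;
  clbot : clX;
  clE_meet : forall a b, clE (clmeet a b) = clE a `&` clE b;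
  clI_join : forall a b, clI (cljoin a b) = clI a `&` clI b;
  clE_top : clE cltop = setT;
  clI_bot : clI clbot = setT;
  clFi : Type;
  clId : Type;
  clmF : clFi -> set clX;
  clmI : clId -> set clX;
  clmeets : clFi -> clId -> Prop;
  clmeetsP : forall F I, clmeets F I <-> exists2 a, clmF F a & clmI I a;
  clmF_neq0 : forall F, clmF F !=set0;
  clmF_up : forall F a b, clE a `<=` clE b -> clmF F a -> clmF F b;
  clmF_meet : forall F a b, clmF F a -> clmF F b -> clmF F (clmeet a b);
  clmF_ex : forall Y : set clX, Y !=set0 ->
    (forall a b, clE a `<=` clE b -> Y a -> Y b) ->
    (forall a b, Y a -> Y b -> Y (clmeet a b)) -> exists F, clmF F = Y;
  clmI_neq0 : forall I, clmI I !=set0;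
  clmI_down : forall I a b, clI a `<=` clI b -> clmI I a -> clmI I b;
  clmI_join : forall I a b, clmI I a -> clmI I b -> clmI I (cljoin a b);
  clmI_ex : forall Y : set clX, Y !=set0 ->
    (forall a b, clI a `<=` clI b -> Y a -> Y b) ->
    (forall a b, Y a -> Y b -> Y (cljoin a b)) -> exists I, clmI I = Y
}.

Definition dual (G : concept_lattice) : concept_lattice :=
  @ConceptLattice _ _ (converse (@clN G)) (clX G) (@clI G) (@clE G)
    (@clE_I G) (@clI_E G) (@cljoin G) (@clmeet G) (clbot G) (cltop G)
    (@clI_join G) (@clE_meet G) (@clI_bot G) (@clE_top G)
    (clId G) (clFi G) (@clmI G) (@clmF G) (converse (@clmeets G))
    (fun I F => iff_trans (clmeetsP F I)
       (conj (fun h => let: ex_intro2 a p q := h in ex_intro2 _ _ a q p)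
             (fun h => let: ex_intro2 a p q := h in ex_intro2 _ _ a q p)))
    (@clmI_neq0 G) (@clmI_down G) (@clmI_join G) (@clmI_ex G)
    (@clmF_neq0 G) (@clmF_up G) (@clmF_meet G) (@clmF_ex G).

Definition omem (G : concept_lattice) e :
    osel (clFi G) (clId G) e -> set G :=
  match e with otpos => @clmF G | otneg => @clmI G end.

Definition ocell (G : concept_lattice) e (a : G) : set (osel (clA G) (clB G) e) :=
  oset e (clE a) (clI a).
Arguments ocell {G} e a _.

Definition oclmeet (G : concept_lattice) e (a b : G) : G :=
  match e with otpos => clmeet a b | otneg => cljoin a b end.

Section ConceptLatticeTheory.
Context (G : concept_lattice).
Implicit Types (a b : G).

Lemma clE_sub a b : clI b `<=` clI a -> clE a `<=` clE b.
Proof. by rewrite !clE_I; exact: down_anti. Qed.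

Lemma clI_sub a b : clE b `<=` clE a -> clI a `<=` clI b.
Proof. by rewrite !clI_E; exact: up_anti. Qed.

Lemma ocell_meet e a b : ocell e (oclmeet e a b) = ocell e a `&` ocell e b.
Proof. by case: e; [exact: clE_meet|exact: clI_join]. Qed.

Lemma omem_neq0 e (F : osel (clFi G) (clId G) e) : omem F !=set0.
Proof. by case: e F; [exact: clmF_neq0|exact: clmI_neq0]. Qed.

Lemma omem_meet e (F : osel (clFi G) (clId G) e) a b :
  omem F a -> omem F b -> omem F (oclmeet e a b).
Proof. by case: e F => F; [exact: clmF_meet|exact: clmI_join]. Qed.

Lemma omem_dir e (F : osel (clFi G) (clId G) e) (s : seq G) :
  exists2 a, omem F a & forall b, b \in s -> omem F b -> ocell e a `<=` ocell e b.
Proof.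
elim: s => [|c s [a Fa aP]]; first by have [a Fa] := omem_neq0 F; exists a.
have [Fc|nFc] := pselect (omem F c); last first.
  by exists a => // b; rewrite inE => /orP[/eqP-> //|]; exact: aP.
exists (oclmeet e a c); first exact: omem_meet.
move=> b; rewrite ocell_meet inE => /orP[/eqP-> _ x []//|bs Fb x [ax _]].
exact: aP ax.
Qed.

End ConceptLatticeTheory.

(** * The relations S and T and their Galois properties *)

Section LiftedRelations.
Context (J : Type) (V : set_system J) {FV : UltraFilter V}.

(** For [otpos] this is a^*, for [otneg] it is a_*. *)
Definition ocellU (G : concept_lattice) e (a : G) :
    set (osel (upow (FV := FV) (clA G)) (upow (FV := FV) (clB G)) e) :=
  [set x | V [set j | ocell e a (orepr x j)]].
Arguments ocellU {G} e a _.

Definition lift_S (G : concept_lattice) (x : upow (FV := FV) (clA G)) (I : clId G) : Prop :=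
  exists2 a, clmI I a & ocellU otpos a x.

Definition lift_T (G : concept_lattice) (y : upow (FV := FV) (clB G)) (F : clFi G) : Prop :=
  exists2 a, clmF F a & ocellU otneg a y.

(** The argument sets on the right of [pmor_F], and for the dual lattice of [pmor_G]. *)
Definition point_closure (G : concept_lattice) e :
    osel (clFi G) (clId G) e -> set (osel (upow (FV := FV) (clA G)) (upow (FV := FV) (clB G)) e) :=
  match e with
  | otpos => fun F => gdown (upow_rel (@clN G)) [set y | lift_T y F]
  | otneg => fun I => gup (upow_rel (@clN G)) [set x | lift_S x I]
  end.

Section Basic.
Context (G : concept_lattice).
Local Notation NU := (upow_rel (FV := FV) (@clN G)).

Lemma ocellU_N (a : G) x y : ocellU otpos a x -> ocellU otneg a y -> NU x y.
Proof.
move=> ax ay; apply: filterS (filterI ax ay) => j [].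
by rewrite /ocell /= clI_E => ex; apply.
Qed.

Lemma ocellU_sub e (a b : G) : ocell e a `<=` ocell e b -> ocellU e a `<=` ocellU e b.
Proof. by move=> ab x; apply: filterS => j; exact: ab. Qed.

Lemma ocellU_meet e (a b : G) x :
  ocellU e a x -> ocellU e b x -> ocellU e (oclmeet e a b) x.
Proof.
by move=> ax bx; rewrite /ocellU ocell_meet; exact: filterI.
Qed.

(** With this filter, [lift_S x I] amounts to [clmeets F I]. *)
Lemma point_filter (x : upow (FV := FV) (clA G)) :
  exists F, forall a, clmF F a <-> ocellU otpos a x.
Proof.
have [| | |F FE] := @clmF_ex G (ocellU (G := G) otpos ^~ x).
- exists (cltop G); apply: filterS filterT => j _.
  by rewrite /mkset /ocell /= clE_top.
- by move=> a b ab; exact: (@ocellU_sub otpos).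
- by move=> a b; exact: (@ocellU_meet otpos).
- by exists F => a; rewrite FE.
Qed.

End Basic.

(** For a single [a], almost every coordinate of [y] misses the intension of [a], hence is unrelated
    to some point of its extension; saturation makes the choice uniform in [a]. *)
Lemma separate_point (G : concept_lattice) (P : set G) (y : upow (FV := FV) (clB G)) :
  saturating V G ->
  (forall s : seq G, exists2 a, P a &
    forall b, b \in s -> P b -> clE a `<=` clE b) ->
  (forall a, P a -> ~ ocellU otneg a y) ->
  exists2 x, forall a, P a -> ocellU otpos a x & ~ upow_rel (@clN G) x y.
Proof.
move=> sat dirP Py.
have [|x xP] := tuple_saturation sat (I := unit) (Y := fun=> clA G)
  (P := fun=> P) (C := fun=> @clE G)
  (D := fun j x => ~ clN (x tt) (urepr y j)) (fun=> dirP).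
  move=> a Pa; have [//|na] := in_ultra_setVsetC
    [set j | ocell otneg (a tt) (urepr y j)] FV.
    by move/(Py _ (Pa tt)).
  apply: filterS na => j /= na; apply: contrapT => nx; apply: na.
  rewrite /ocell /= clI_E => x ax; apply: contrapT => nN; apply: nx.
  by exists (fun=> x) => // -[].
have h := urepr_class (FV := FV) (fun j => x j tt).
exists (uclass (FV := FV) (fun j => x j tt)) => [a Pa|].
  apply: filterS (filterI h (xP a)) => j [/= e [_ /(_ tt Pa)]].
  by rewrite /ocell /= e.
(* The [D] part of [xP] does not depend on [a]; any element gives access to it. *)
have [a _ _] := dirP [::].
move=> nN; have [j [[[/= e Nj] [+ _]]]] := filter_ex (filterI (filterI h nN) (xP a)).
by rewrite -e.
Qed.

Section Saturated.
Context (G : concept_lattice) (sat : saturating V G).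
Local Notation NU := (upow_rel (FV := FV) (@clN G)).

Lemma ocellU_down (a : G) : gdown NU (ocellU otneg a) `<=` ocellU otpos a.
Proof.
move=> x xP; apply: contrapT => nx.
have [|_ ->//|y yP ny] := @separate_point (dual G) [set a] x sat.
  by move=> s; exists a => // b _ ->.
by apply: ny; apply: xP; apply: yP.
Qed.

(** A [y] outside is separated by an [x] in a^* for all [a] in [F], and such an [x] lies in the
    polar. *)
Lemma lift_T_stable (F : clFi G) : stable_r NU [set y | lift_T y F].
Proof.
apply: stable_rP => y yP; apply: contrapT => ny.
have [|a Fa ay|x xP nN] := @separate_point G (clmF F) y sat.
- exact: (@omem_dir G otpos F).
- by apply: ny; exists a.
- by apply: nN; apply: yP => z [a /xP Fa az]; exact: ocellU_N az.
Qed.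

Lemma lift_T_stable1 (y : upow (FV := FV) (clB G)) :
  stable_l (@clmeets G) [set F | lift_T y F].
Proof.
have [I IP] := @point_filter (dual G) y.
suff -> : [set F | lift_T y F] = [set F | clmeets F I] by exact: stable_l1.
apply/seteqP; split=> F.
  by move=> [a Fa ay]; apply/clmeetsP; exists a => //; apply/IP.
by move=> /clmeetsP[a Fa /IP ay]; exists a.
Qed.

End Saturated.

Section Morphism.
Context (G : concept_lattice) (sat : saturating V G).
Local Notation NU := (upow_rel (FV := FV) (@clN G)).

Lemma lift_TS (F : clFi G) : gdown NU [set y | lift_T y F] `<=`
  sec0 (@lift_S G) (gup (@clmeets G) [set F]).
Proof.
move=> x xP I /(_ F erefl) /clmeetsP[a Fa Ia]; exists a => //.
by apply: ocellU_down => // y ay; apply: xP; exists a.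
Qed.

(** Testing [y] on the filter of all [a] with [x] in a^* yields one such [a] with [y] in a_*. *)
Lemma lift_ST (x : upow (FV := FV) (clA G)) :
  sec0 (@lift_T G) (gdown (@clmeets G) [set I | lift_S x I]) `<=` gup NU [set x].
Proof.
have [F FP] := point_filter x.
move=> y yP _ ->; have [I|a /FP ax ay] := yP F; last exact: ocellU_N ay.
by move=> [a Ia ax]; apply/clmeetsP; exists a => //; apply/FP.
Qed.

(** This turns the closure into an internal type, to which saturation applies. *)
Lemma point_closureE e (F : osel (clFi G) (clId G) e) :
  point_closure F = [set x | forall a, omem F a -> ocellU e a x].
Proof.
case: e F => F; apply/seteqP; split=> x xP.
- by move=> a Fa; apply: ocellU_down => // y ay; apply: xP; exists a.
- by move=> y [a Fa ay]; apply: ocellU_N ay; exact: xP.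
- move=> a Fa; apply: (@ocellU_down (dual G)) => // y ay.
  by apply: xP; exists a.
- by move=> y [a Fa ay]; apply: ocellU_N ay _; exact: xP.
Qed.

Section Operation.
Context (n : nat) (eps : 'I_n -> order_type).
Context (R : clB G -> (forall i, osel (clA G) (clB G) (eps i)) -> Prop).
Context (h : ('I_n -> G) -> G).
Context (hP : forall a, clI (h a) = nsec0 R (fun i => ocell (eps i) (a i))).
Context (F : forall i, osel (clFi G) (clId G) (eps i)).

Lemma op_mono (a b : 'I_n -> G) :
  (forall i, ocell (eps i) (a i) `<=` ocell (eps i) (b i)) ->
  clE (h a) `<=` clE (h b).
Proof.
move=> ab; apply: clE_sub; rewrite !hP => y yP x xa.
by apply: yP => i; apply: ab.
Qed.

(** Computes the left side of [pmor_F]; [lift_T_nrel] finds the same set on the right. *)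
Lemma lift_T_op :
  sec0 (@lift_T G) (gdown (@clmeets G)
    [set I | exists a, (forall i, omem (F i) (a i)) /\ clmI I (h a)]) =
  [set y | exists2 a, forall i, omem (F i) (a i) & ocellU otneg (h a) y].
Proof.
apply/seteqP; split=> y.
  (* [H] is the filter generated by the values [h a] with each [a i] in [F i]. *)
  have [| | |H HE] := @clmF_ex G
    [set c | exists2 a, forall i, omem (F i) (a i) & clE (h a) `<=` clE c].
  - have /boolp.choice[a aP] := fun i => omem_neq0 (F i).
    by exists (h a), a.
  - by move=> a b ab [c Fc ca]; exists c => //; exact: subset_trans ab.
  - move=> a b [c Fc ca] [d Fd db].
    exists (fun i => oclmeet (eps i) (c i) (d i)).
      by move=> i; apply: omem_meet.
    rewrite clE_meet => x xP; split; [apply: ca|apply: db]; apply: op_mono xP => i;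
      by rewrite ocell_meet => z [].
  move=> /(_ H)[|c].
    move=> I [a [Fa Ia]]; apply/clmeetsP; exists (h a) => //.
    by rewrite HE; exists a.
  rewrite HE => -[a Fa ac] cy; exists a => //.
  by apply: ocellU_sub cy; exact: clI_sub.
move=> [a Fa ay] H HP; exists (h a) => //.
(* The principal ideal of [h a] forces [h a] into [H]. *)
have [| | |I IE] := @clmI_ex G [set c | clE c `<=` clE (h a)].
- by exists (h a).
- by move=> c d /clE_sub dc; exact: subset_trans.
- move=> c d /clI_sub ca /clI_sub da; apply: clE_sub; rewrite clI_join => x ax.
  by split; [exact: ca|exact: da].
have /clmeetsP[c Hc] : clmeets H I by apply: HP; exists a; split=> //; rewrite IE.
by rewrite IE => /clmF_up; apply.
Qed.

(** If [y] lies in no such cell, almost every coordinate has, for each [a], a tuple in the cells of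
    [a] violating [R]; saturation yields one violating tuple in all the closures. *)
Lemma lift_T_nrel :
  nsec0 (upow_nrel R) (fun i => point_closure (F i)) =
  [set y | exists2 a, forall i, omem (F i) (a i) & ocellU otneg (h a) y].
Proof.
apply/seteqP; split=> y yP; last first.
  move: yP => [a Fa ay] x xP.
  have xa i : V [set j | ocell (eps i) (a i) (orepr (x i) j)].
    by have := xP i; rewrite point_closureE; apply.
  apply: filterS (filterI ay (filter_forall_ord xa)) => j [].
  by rewrite /mkset /ocell /= hP; apply.
apply: contrapT => ny.
have [|a Fa|x xP] := tuple_saturation sat (P := fun i => omem (F i))
  (C := fun i => @ocell G (eps i)) (D := fun j x => ~ R (urepr y j) x).
- by move=> i s; exact: omem_dir.
- have [ay|na] := in_ultra_setVsetC
    [set j | ocell otneg (h a) (urepr y j)] FV.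
    by case: ny; exists a.
  apply: filterS na => j /= na; apply: contrapT => nx; apply: na.
  rewrite /ocell /= hP => x ax; apply: contrapT => nR; apply: nx.
  by exists x.
pose z i := oclass (FV := FV) (fun j => x j i).
have zx := @filter_forall_ord _ V FV _ _ (fun i => orepr_class (FV := FV) (fun j => x j i)).
have : upow_nrel R y z.
  apply: yP => i; rewrite point_closureE => a Fa.
  apply: filterS (filterI zx (xP a)) => j [/= e [_ /(_ i Fa)]].
  by rewrite /z e.
have top : G := cltop G.
move=> Ry; have [j [[/= e Rj] [+ _]]] := filter_ex (filterI (filterI zx Ry) (xP top)).
by rewrite -(functional_extensionality_dep e).
Qed.

End Operation.

End Morphism.

(** For surjectivity. If the extension of some [a] in [F] were contained in that of some [c] in [I],
    then [c] would lie in both. *)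
Lemma separate_filter_ideal (G : concept_lattice) (F : clFi G) (I : clId G) :
  saturating V G -> ~ clmeets F I ->
  exists2 x : upow (FV := FV) (clA G), forall a, clmF F a -> ocellU otpos a x
    & ~ lift_S x I.
Proof.
move=> sat nFI.
(* Two coordinates forced equal: one carries the conditions from [F], the other the negated
   conditions from [I]. *)
have [|a Pa|x xP] := tuple_saturation sat (I := bool) (Y := fun=> clA G)
  (P := fun b => if b then clmF F else clmI I)
  (C := fun b c => if b then clE c else ~` clE c)
  (D := fun j x => x true = x false).
- case=> s; first exact: (@omem_dir G otpos F).
  have [a Ia aP] := @omem_dir G otneg I s; exists a => // b bs Ib x.
  by apply: contra_not; apply: clE_sub; exact: aP.
- have [x [ax nx]] : exists x, clE (a true) x /\ ~ clE (a false) x.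
    apply: contrapT => h; apply: nFI; apply/clmeetsP; exists (a false).
      apply: clmF_up (Pa true) => x ax.
      by apply: contrapT => nx; apply: h; exists x.
    exact: Pa false.
  by apply: filterS filterT => j _; exists (fun=> x) => // -[].
have h := urepr_class (FV := FV) (fun j => x j true).
exists (uclass (FV := FV) (fun j => x j true)) => [a Fa|[a Ia ax]].
  apply: filterS (filterI h (xP a)) => j [/= e [_ /(_ true Fa)]].
  by rewrite /ocell /= e.
have [j [[[/= e ej] [xe /(_ false Ia)]]]] := filter_ex (filterI (filterI h ax) (xP a)).
by apply; rewrite -xe -e.
Qed.

End LiftedRelations.

(** * Application to the complex algebra of a frame *)

Section FrameLattice.
Context (L : LEsignature) (F : LEframe L).
Local Notation A := (alg_lat (complex_algebra F)).

Lemma concept_leP (a b : concept F) :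
  reflect (ext a `<=` ext b) ((a : A) <= (b : A))%O.
Proof. exact: asboolP. Qed.

Lemma concept_le_intP (a b : concept F) :
  reflect (int b `<=` int a) ((a : A) <= (b : A))%O.
Proof. by rewrite /Order.le /= concept_le_int; exact: asboolP. Qed.

(** Kept transparent, so that the clauses of [pmorphism] match the abstract lemmas by conversion. *)
Definition frame_lattice : concept_lattice.
Proof.
refine (@ConceptLattice (polW F) (polU F) (polN F) (concept F)
  (@ext F) (@int F) (@int_ext F) (@ext_int F)
  (@concept_meet F) (@concept_join F) (concept_top F) (concept_bot F)
  (fun _ _ => erefl) (fun _ _ => erefl) erefl erefl
  (lfilter A) (lideal A) (@lfilter_set _ A) (@lideal_set _ A) (@fi_N _ A)
  _ (@lfilter_neq0 _ A) _ (@lfilter_meet _ A) _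
  (@lideal_neq0 _ A) _ (@lideal_join _ A) _).
- by move=> X I; split=> [[c [Xc Ic]]|[c Xc Ic]]; exists c.
- by move=> X c d /concept_leP; exact: lfilter_le.
- move=> Y Y0 Yup Ymeet.
  have Yle (x y : A) : (x <= y)%O -> Y x -> Y y by move=> /concept_leP; exact: Yup.
  by exists (@LFilter _ A Y Y0 Yle Ymeet).
- by move=> I c d /concept_le_intP; exact: lideal_le.
- move=> Y Y0 Ydown Yjoin.
  have Yle (x y : A) : (y <= x)%O -> Y x -> Y y.
    by move=> /concept_le_intP; exact: Ydown.
  by exists (@LIdeal _ A Y Y0 Yle Yjoin).
Defined.

End FrameLattice.

Section FrameMorphism.
Context (L : LEsignature) (F : LEframe L).
Context (J : Type) (V : set_system J) (FV : UltraFilter V).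
Context (sat : saturating V (concept F)).
Local Notation G := (frame_lattice F).
Local Notation S := (@lift_S J V FV G).
Local Notation T := (@lift_T J V FV G).

Lemma lift_pmorphism :
  @pmorphism L (ultrapower V F) (filter_ideal_frame (complex_algebra F)) S T.
Proof.
split.
(* [S] is by conversion the relation [lift_T] of the dual lattice. *)
- exact: (@lift_T_stable J V FV (dual G) sat).
- exact: (@lift_T_stable1 J V FV (dual G)).
- exact: (@lift_T_stable J V FV G sat).
- exact: (@lift_T_stable1 J V FV G).
- exact: (@lift_TS J V FV G sat).
- exact: (@lift_ST J V FV G).
- move=> f w.
  have h := @lift_T_op J V FV G _ _ _ (@complex_F L F f) (fun _ => erefl) w.
  have k := @lift_T_nrel J V FV G sat _ _ _ (@complex_F L F f) (fun _ => erefl) w.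
  exact: etrans h (esym k).
- move=> g u.
  have h := @lift_T_op J V FV (dual G) _ _ _ (@complex_G L F g) (fun _ => erefl) u.
  have k := @lift_T_nrel J V FV (dual G) sat _ _ _ (@complex_G L F g)
    (fun _ => erefl) u.
  exact: etrans h (esym k).
Qed.

Lemma lift_S_inj
    (a b : concept (filter_ideal_frame (complex_algebra F))) :
  sec0 S (int a) = sec0 S (int b) -> a = b.
Proof.
suff sub (c d : concept (filter_ideal_frame (complex_algebra F))) :
    sec0 S (int c) = sec0 S (int d) -> int c `<=` int d.
  by move=> e; apply: int_inj; apply/seteqP; split; apply: sub.
move=> e I cI; rewrite int_ext => X dX; apply: contrapT => nXI.
(* This [x] is related by [S] to every ideal meeting [X], hence to all of [int d], but not to
   [I]. *)
have [x xX nx] := @separate_filter_ideal J V FV G X I sat nXI.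
suff : sec0 S (int c) x by move=> /(_ I cI).
rewrite e => I' dI'; rewrite ext_int in dX.
by have [m [/xX mx I'm]] := dX I' dI'; exists m.
Qed.

End FrameMorphism.

Theorem mainTheorem2 (L : LEsignature) (F : LEframe L) :
  exists (J : Type) (V : set_system J) (FV : UltraFilter V)
    (S : polW (ultrapower V F) ->
         polU (filter_ideal_frame (complex_algebra F)) -> Prop)
    (T : polU (ultrapower V F) ->
         polW (filter_ideal_frame (complex_algebra F)) -> Prop),
    surjective_pmorphism S T.
Proof.
have [J [V [FV sat]]] := saturated_ultrafilter (concept F).
exists J, V, FV, (@lift_S J V FV (frame_lattice F)),
  (@lift_T J V FV (frame_lattice F)); split; first exact: lift_pmorphism.
by move=> a b + /(lift_S_inj sat).
Qed.
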